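(* Let $f\colon(0,\infty)\to[0,\infty)$ be completely increasing (respectively, completely decreasing). 1. Then for every $n\in\mathbb{N}$ the limits $$f^{(n-1)}(0):=\lim_{x\to 0^+}f^{(n-1)}(x)\quad\text{and}\quad f^{(n-1)}(\infty):=\lim_{x\to\infty}f^{(n-1)}(x)$$ exist in the extended real line $\overline{\mathbb{R}}=[-\infty,\infty]$. 2. Let, also, $x_1,\dots,x_n\in(0,\infty)$ be pairwise distinct, with $m:=\min_{i\in\{1,\dots,n\}}x_i$ and $M:=\max_{i\in\{1,\dots,n\}}x_i$. If $f$ is completely increasing, then for all $(a,b)\in[0,m]\times[M,\infty]$, $$\frac{(-1)^{n-1}}{(n-1)!}f^{(n-1)}(a)\ \le\ \sum_{i=1}^n\frac{f(x_i)}{\prod_{1\le j\le n,\ j\ne i}(x_j-x_i)}\ \le\ \frac{(-1)^{n-1}}{(n-1)!}f^{(n-1)}(b).$$ If $f$ is completely decreasing, then for all $(a,b)\in[0,m]\times[M,\infty]$, $$\frac{(-1)^{n-1}}{(n-1)!}f^{(n-1)}(b)\ \le\ \sum_{i=1}^n\frac{f(x_i)}{\prod_{1\le j\le n,\ j\ne i}(x_j-x_i)}\ \le\ \frac{(-1)^{n-1}}{(n-1)!}f^{(n-1)}(a).$$ If, in addition, $f$ is strictly completely increasing (respectively, strictly completely decreasing), then the inequalities in the corresponding display are strict.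
   Context: $\mathbb{N}=\{1,2,3,\dots\}$; $f^{(k)}$ denotes the $k$-th derivative of $f$, with $f^{(0)}=f$; an empty product equals $1$. A function $f\in C^\infty((0,\infty);[0,\infty))$ is called completely increasing if $(-1)^n f^{(n)}(x)\le 0$ for all $(x,n)\in(0,\infty)\times\mathbb{N}$, and completely decreasing if $(-1)^n f^{(n)}(x)\ge 0$ for all $(x,n)\in(0,\infty)\times\mathbb{N}$. It is called strictly completely increasing (respectively, strictly completely decreasing) if the corresponding inequality is strict. For $a=0$ or $b=\infty$, the values $f^{(n-1)}(0)$ and $f^{(n-1)}(\infty)$ are the limits in $\overline{\mathbb{R}}$ defined in part 1, and the inequalities are understood in $\overline{\mathbb{R}}$.
   Formalization: For n=1 the left (right) endpoint's strict inequality is asserted only when a≠m (resp. b≠M), since with a=m=x_1 or b=M=x_1 it would read f(x_1)<f(x_1), which is false; for n≥2 strictness is asserted for all a and b. *)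

(* Defs.v *)
From HB Require Import structures.
From mathcomp Require Export all_boot all_order all_algebra.
From mathcomp Require Export all_classical all_reals all_analysis.

Set Implicit Arguments.
Unset Strict Implicit.
Unset Printing Implicit Defensive.

Export Order.TTheory GRing.Theory Num.Theory.
Export numFieldNormedType.Exports.

Local Open Scope classical_set_scope.
Local Open Scope ring_scope.

(* Functions on the open half-line are represented by total functions
   [f : R -> R] that are only inspected at positive points; the derivative
   [derive1n n f] at such a point depends only on [f] near that point. *)

Definition smooth_on_pos (R : realType) (f : R -> R) : Prop :=
  forall (n : nat) (x : R), 0 < x -> derivable (derive1n n f) x 1.

Definition nonneg_on_pos (R : realType) (f : R -> R) : Prop :=
  forall x : R, 0 < x -> 0 <= f x.

Definition completely_increasing (R : realType) (f : R -> R) : Prop :=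
  [/\ nonneg_on_pos f, smooth_on_pos f &
      forall (x : R) (n : nat), 0 < x -> (0 < n)%N ->
        (-1) ^+ n * derive1n n f x <= 0].

Definition completely_decreasing (R : realType) (f : R -> R) : Prop :=
  [/\ nonneg_on_pos f, smooth_on_pos f &
      forall (x : R) (n : nat), 0 < x -> (0 < n)%N ->
        0 <= (-1) ^+ n * derive1n n f x].

Definition strictly_completely_increasing (R : realType) (f : R -> R) : Prop :=
  [/\ nonneg_on_pos f, smooth_on_pos f &
      forall (x : R) (n : nat), 0 < x -> (0 < n)%N ->
        (-1) ^+ n * derive1n n f x < 0].

Definition strictly_completely_decreasing (R : realType) (f : R -> R) : Prop :=
  [/\ nonneg_on_pos f, smooth_on_pos f &
      forall (x : R) (n : nat), 0 < x -> (0 < n)%N ->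
        0 < (-1) ^+ n * derive1n n f x].

(* The [k]-th derivative of [f] on the closed half-line [0, +oo], with its
   limits in [\bar R] as boundary values; negative arguments and [-oo] are
   junk. *)
Definition ext_derive (R : realType) (f : R -> R) (k : nat) (t : \bar R) :
    \bar R :=
  match t with
  | EFin r => if r == 0 then lim ((derive1n k f x)%:E @[x --> 0^'+])
              else (derive1n k f r)%:E
  | EPInf => lim ((derive1n k f x)%:E @[x --> +oo])
  | ENInf => 0%E
  end.

Definition scaled_ext_derive (R : realType) (f : R -> R) (k : nat)
    (t : \bar R) : \bar R :=
  (((-1) ^+ k / k`!%:R)%:E * ext_derive f k t)%E.

Definition node_sum (R : realType) (f : R -> R) (k : nat) (x : 'I_k -> R) : R :=
  \sum_(i < k) f (x i) / \prod_(j < k | j != i) (x j - x i).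

(* Main.v *)
(* Up to the sign (-1)^n, the node sum is the leading coefficient of the Lagrange
   interpolant p of f at the n+1 nodes.  Since f - p vanishes at the nodes,
   iterating Rolle's theorem gives a zero xi of its n-th derivative between the
   extreme nodes, so the node sum equals (-1)^n / n! * f^(n)(xi).  The sign of
   f^(n+1) makes t |-> (-1)^n / n! * f^(n)(t) monotone, which yields the limits at
   0 and +oo as well as the bounds. *)
Require Import Defs.
From mathcomp Require Import ring lra.

Local Open Scope classical_set_scope.
Local Open Scope ring_scope.

(** * Iterated Rolle theorem on the positive half-line *)

Lemma is_derive_derive1n {R : realType} (f : R -> R) (k : nat) (t : R) :
  smooth_on_pos f -> 0 < t ->
  is_derive t (1 : R) (derive1n k f) (derive1n k.+1 f t).
Proof.
by move=> sf t0; apply: DeriveDef; [exact: sf|rewrite derive1nS derive1E].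
Qed.

Lemma rolle_pos {R : realType} (h h' : R -> R) (a b : R) :
  (forall x : R, 0 < x -> is_derive x (1 : R) h (h' x)) ->
  0 < a -> a < b -> h a = 0 -> h b = 0 ->
  exists2 c, a < c < b & h' c = 0.
Proof.
move=> dh a0 ab ha hb.
have dh1 x : 0 < x -> derivable h x 1 by move=> /dh [].
have [||c cab dc] := @Rolle R h a b ab _ _ (etrans ha (esym hb)).
- by move=> x; rewrite in_itv/= => /andP[ax _]; exact/dh1/(lt_trans a0).
- apply: derivable_within_continuous => x; rewrite in_itv/= => /andP[ax _].
  exact/dh1/(lt_le_trans a0).
- move: cab; rewrite in_itv/= => cab; exists c => //.
  have [ac _] := andP cab.
  by have [_ <-] := dh _ (lt_trans a0 ac); case: dc.
Qed.

(** Rolle's theorem on each gap between consecutive zeros of [h]. The zeros of [h'] come back as a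
    sorted head and tail, the shape of the input, so that the lemma can be iterated; the strict end
    inequalities keep track of where they lie. *)
Lemma rolle_interlace {R : realType} (h h' : R -> R) (x : R) (s : seq R) :
  (forall x : R, 0 < x -> is_derive x (1 : R) h (h' x)) ->
  0 < x -> path <%R x s -> {in x :: s, forall z, h z = 0} -> s != [::] ->
  exists (y : R) (t : seq R),
    [/\ size s = (size t).+1, path <%R y t, {in y :: t, forall z, h' z = 0},
        x < y & last y t < last x s].
Proof.
move=> dh; elim: s x => [//|z s IH] x x0 /= /andP[xz pzs] hzs _.
have [||c /andP[xc cz] hc] := rolle_pos _ _ _ _ dh x0 xz.
- by apply: hzs; rewrite mem_head.
- by apply: hzs; rewrite !inE eqxx orbT.
case: s IH pzs hzs => [|w s] IH pzs hzs.
  exists c, [::]; split => //= u; rewrite inE => /eqP ->//.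
have [|y [t [st pt ht zy lt]]] := IH z (lt_trans x0 xz) pzs _ isT.
  by move=> u us; apply: hzs; rewrite inE us orbT.
(* The new zero [c] lies before [z] and the inductive ones after it, so prepending [c] keeps the
   list sorted. *)
exists c, (y :: t); split => //=; first by rewrite -st.
- by rewrite (lt_trans cz zy).
- by move=> u; rewrite inE => /orP[/eqP ->//|/ht].
Qed.

(** Each step differentiates once and loses one zero, so after [size s] steps exactly one is left.
    With a single zero no step is made and [xi] is [x] itself, hence the guard on the strict
    bounds. *)
Lemma rolle_iter {R : realType} (h : nat -> R -> R) (x : R) (s : seq R) :
  (forall k (x : R), 0 < x -> is_derive x (1 : R) (h k) (h k.+1 x)) ->
  0 < x -> path <%R x s -> {in x :: s, forall z, h 0%N z = 0} ->
  exists xi, [/\ h (size s) xi = 0, x <= xi <= last x s &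
                 (0 < size s)%N -> x < xi < last x s].
Proof.
move: {2}(size s) (erefl (size s)) => n.
elim: n h x s => [|n IH] h x s sn dh x0 ps hs.
  move: sn => /size0nil ->/=; exists x; split => //; last by rewrite !lexx.
  by apply: hs; rewrite mem_head.
have s0 : s != [::] by case: s sn {ps hs}.
have [y [t [st pt ht xy lt]]] := rolle_interlace _ _ _ _ (dh 0%N) x0 ps hs s0.
(* The induction hypothesis is used for the family shifted by one derivative. *)
have [|xi [hxi /andP[yxi xit] _]] :=
  IH (fun k => h k.+1) y t _ (fun k => dh k.+1) (lt_trans x0 xy) pt ht.
  by move: st; rewrite sn => -[].
have xb : x < xi < last x s by rewrite (lt_le_trans xy yxi) (le_lt_trans xit lt).
exists xi; split => //; first by rewrite st.
by have /andP[? ?] := xb; rewrite !ltW.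
Qed.

(** * Lagrange interpolation and a mean value formula for the node sum *)

(** The Lagrange basis numerators [q i] are monic of degree [n], so the coefficient of degree [n] of
    the interpolant is the sum of their weights. *)
Lemma lagrange_interpolation {F : fieldType} {n : nat} (x y : 'I_n.+1 -> F) :
  injective x ->
  exists p : {poly F}, [/\ (size p <= n.+1)%N, forall i, p.[x i] = y i &
    p`_n = \sum_(i < n.+1) y i / \prod_(j < n.+1 | j != i) (x i - x j)].
Proof.
move=> xI.
have den0 i : \prod_(j < n.+1 | j != i) (x i - x j) != 0.
  by apply/prodf_neq0 => j ji; rewrite subr_eq0 (inj_eq xI) eq_sym.
pose q i : {poly F} := \prod_(j < n.+1 | j != i) ('X - (x j)%:P).
have sq i : size (q i) = n.+1.
  rewrite /q -(big_enum _ _ (predC1 i)) size_prod_XsubC -cardE cardC1.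
  by rewrite card_ord.
exists (\sum_i (y i / \prod_(j < n.+1 | j != i) (x i - x j)) *: q i); split.
- apply: (leq_trans (size_sum _ _ _)); apply/bigmax_leqP => i _.
  by apply: (leq_trans (size_scale_leq _ _)); rewrite sq.
- move=> i.
  have qx k : (q k).[x i] = \prod_(j < n.+1 | j != k) (x i - x j).
    by rewrite horner_prod; apply: eq_bigr => j _; rewrite hornerXsubC.
  rewrite horner_sum (bigD1 i)//= [X in _ + X]big1 ?addr0 => [|k ki].
    by rewrite hornerZ qx divfK.
  (* For [k != i] the product contains the factor [x i - x i]. *)
  rewrite hornerZ qx [X in _ * X](bigD1 i)/=; last by rewrite eq_sym.
  by rewrite subrr mul0r mulr0.
- rewrite coef_sum; apply: eq_bigr => i _; rewrite coefZ.
  have /monicP : q i \is monic by exact: monic_prod_XsubC.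
  by rewrite lead_coefE sq /= => ->; rewrite mulr1.
Qed.

(** Each denominator has [n] factors, and reversing all of them produces the sign. *)
Lemma node_sumE {R : realType} (f : R -> R) (n : nat) (x : 'I_n.+1 -> R) :
  node_sum f x = (-1) ^+ n *
    \sum_(i < n.+1) f (x i) / \prod_(j < n.+1 | j != i) (x i - x j).
Proof.
rewrite /node_sum mulr_sumr; apply: eq_bigr => i _.
under eq_bigr do rewrite -opprB -mulN1r.
rewrite big_split/= prodr_const cardC1 card_ord/= invfM mulrCA.
by rewrite -exprVn invrN invr1.
Qed.

Lemma derivn_const {F : fieldType} (p : {poly F}) (n : nat) (x : F) :
  (size p <= n.+1)%N -> p^`(n).[x] = n`!%:R * p`_n.
Proof.
move=> sp; have s1 : (size p^`(n) <= 1)%N.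
  apply/leq_sizeP => j j0; rewrite coef_derivn nth_default ?mul0rn//.
  by rewrite (leq_trans sp)// -addn1 leq_add2l.
rewrite (size1_polyC s1) hornerC coef_derivn addn0 ffactnn.
by rewrite mulr_natl.
Qed.

Lemma node_sum_mean_value {R : realType} (f : R -> R) (n : nat)
    (x : 'I_n.+1 -> R) (m M : R) :
  smooth_on_pos f -> (forall i, 0 < x i) -> injective x ->
  (forall i, m <= x i <= M) ->
  exists xi, [/\ 0 < xi, m <= xi <= M, (0 < n)%N -> m < xi < M &
    node_sum f x = (-1) ^+ n / n`!%:R * derive1n n f xi].
Proof.
move=> sf x0 xI xmM.
have [p [sp px pn]] := lagrange_interpolation x (f \o x) xI.
(* The successive derivatives of the interpolation error. *)
pose h k (t : R) := derive1n k f t - p^`(k).[t].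
have dh k (t : R) : 0 < t -> is_derive t (1 : R) (h k) (h k.+1 t).
  move=> t0; rewrite /h derivnS.
  exact: is_deriveB (is_derive_derive1n f k t sf t0) (is_derive_poly p^`(k) t).
pose s := sort <=%R [seq x i | i <- enum 'I_n.+1].
have ss : size s = n.+1 by rewrite size_sort size_map size_enum_ord.
(* Injectivity of [x] makes the sorted list of nodes strictly increasing, as Rolle's theorem
   requires. *)
have slt : sorted <%R s.
  by rewrite sort_lt_sorted map_inj_uniq// enum_uniq.
have sx z : z \in s -> exists i, z = x i.
  by rewrite mem_sort => /mapP[i _ ->]; exists i.
case: s ss slt sx => [//|y s] /= [ss] slt sx.
have y0 : 0 < y by have [i ->] := sx y (mem_head _ _).
have h0 : {in y :: s, forall z, h 0%N z = 0}.
  by move=> z /sx[i ->]; rewrite /h/= px subrr.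
have my : m <= y by have [i ->] := sx y (mem_head _ _); have /andP[] := xmM i.
have sM : last y s <= M.
  by have [i ->] := sx _ (mem_last y s); have /andP[] := xmM i.
have [xi [hxi /andP[yxi xis] xii]] := rolle_iter h y s dh y0 slt h0.
exists xi; split.
- exact: lt_le_trans yxi.
- by rewrite (le_trans my yxi) (le_trans xis sM).
- rewrite ss in xii; move=> /xii /andP[yx xs].
  by rewrite (le_lt_trans my yx) (lt_le_trans xs sM).
- move: hxi; rewrite ss /h (derivn_const _ _ _ sp) => /eqP.
  rewrite subr_eq0 => /eqP ->; rewrite node_sumE -pn mulrA divfK//.
Qed.

(** * Limits of monotone functions in the extended reals *)

(** Monotonicity is available for [c * g], whereas [ext_derive] takes the limit of [g].
    Multiplication by the finite number [c^-1] preserves limits even at infinite values, which links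
    the two. *)
Lemma scaled_limit {R : realType} {T : Type} (F : set_system T)
    {FF : ProperFilter F} (g : T -> R) (c : R) (l : \bar R) :
  c != 0 -> (c * g x)%:E @[x --> F] --> l ->
  cvg ((g x)%:E @[x --> F]) /\ (c%:E * lim ((g x)%:E @[x --> F]))%E = l.
Proof.
move=> c0 cl.
have gl : (g x)%:E @[x --> F] --> (c^-1%:E * l)%E.
  have -> : (fun x => (g x)%:E) = (fun x => c^-1%:E * (c * g x)%:E)%E.
    by apply/funext => x; rewrite -EFinM mulKf.
  exact: cvgeZl.
split; first by apply/cvg_ex; eexists; exact: gl.
by rewrite (cvg_lim _ gl)// muleA -EFinM mulfV// mul1e.
Qed.

Lemma nondecreasing_lim0 {R : realType} (g : R -> R) :
  (forall x y, 0 < x -> x <= y -> g x <= g y) ->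
  exists2 l, (g x)%:E @[x --> 0^'+] --> l &
             forall y, 0 < y -> (l <= (g y)%:E)%E.
Proof.
move=> gnd; eexists.
  (* [BInfty R false] is the right bound [+oo]: the limit is the infimum of [g] over all positive
     reals. *)
  apply: (@nondecreasing_at_right_cvge _ _ _ (BInfty R false)) => // x y.
  by rewrite !in_itv/= !andbT lee_fin => x0 y0 xy; exact: gnd.
move=> y y0; apply: ereal_inf_lbound; exists y => //=.
by rewrite in_itv/= y0.
Qed.

Lemma nondecreasing_limy {R : realType} (g : R -> R) :
  (forall x y, 0 < x -> x <= y -> g x <= g y) ->
  exists2 l, (g x)%:E @[x --> +oo] --> l &
             forall y, 0 < y -> ((g y)%:E <= l)%E.
Proof.
move=> gnd.
(* [nondecreasing_cvge] needs monotonicity on all of R. *)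
have gmax1 :
    {homo (fun x => (g (Num.max 1 x))%:E) : x y / x <= y >-> (x <= y)%E}.
  move=> x y xy; rewrite lee_fin gnd//; first by rewrite lt_max ltr01.
  by rewrite ge_max !le_max lexx xy orbT.
exists (ereal_sup (range (fun x => (g (Num.max 1 x))%:E))).
  apply: cvg_trans (nondecreasing_cvge gmax1).
  apply: near_eq_cvg; near=> x; rewrite max_r; first by [].
  by near: x; exact: nbhs_pinfty_ge.
move=> y y0; apply: (@le_trans _ _ (g (Num.max 1 y))%:E).
  by rewrite lee_fin gnd// le_max lexx orbT.
by apply: ereal_sup_ubound; exists y.
Unshelve. all: by end_near. Qed.

(** * Monotonicity of the scaled derivatives and comparison with their boundary values *)

Lemma mean_value_pos {R : realType} (f : R -> R) (n : nat) (x y : R) :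
  smooth_on_pos f -> 0 < x -> x < y ->
  exists2 z, 0 < z &
    derive1n n f y - derive1n n f x = derive1n n.+1 f z * (y - x).
Proof.
move=> sf x0 xy.
have [||z] := @MVT R (derive1n n f) (derive1n n.+1 f) x y xy.
- move=> z; rewrite in_itv/= => /andP[xz _].
  exact/(is_derive_derive1n _ _ _ sf)/(lt_trans x0).
- apply: derivable_within_continuous => z; rewrite in_itv/= => /andP[xz _].
  exact/sf/(lt_le_trans x0).
- rewrite in_itv/= => /andP[xz _] ->; exists z => //.
  exact: lt_trans xz.
Qed.

Lemma derive1n_nondecreasing {R : realType} (f : R -> R) (n : nat) (c : R) :
  smooth_on_pos f -> (forall x, 0 < x -> 0 <= c * derive1n n.+1 f x) ->
  forall x y, 0 < x -> x <= y -> c * derive1n n f x <= c * derive1n n f y.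
Proof.
move=> sf cf x y x0; rewrite le_eqVlt => /predU1P[->//|xy].
have [z z0 fxy] := mean_value_pos f n x y sf x0 xy.
rewrite -subr_ge0 -mulrBr fxy mulrA mulr_ge0 ?cf//.
by rewrite subr_ge0 ltW.
Qed.

Lemma derive1n_increasing {R : realType} (f : R -> R) (n : nat) (c : R) :
  smooth_on_pos f -> (forall x, 0 < x -> 0 < c * derive1n n.+1 f x) ->
  forall x y, 0 < x -> x < y -> c * derive1n n f x < c * derive1n n f y.
Proof.
move=> sf cf x y x0 xy.
have [z z0 fxy] := mean_value_pos f n x y sf x0 xy.
by rewrite -subr_gt0 -mulrBr fxy mulrA mulr_gt0 ?cf// subr_gt0.
Qed.

Lemma cvg_derive1n {R : realType} (f : R -> R) (n : nat) (c : R) :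
  c != 0 -> smooth_on_pos f -> (forall x, 0 < x -> 0 <= c * derive1n n.+1 f x) ->
  cvg ((derive1n n f x)%:E @[x --> 0^'+]) /\
  cvg ((derive1n n f x)%:E @[x --> +oo]).
Proof.
move=> c0 sf cf; have nd := derive1n_nondecreasing f n c sf cf.
have [l fl _] := nondecreasing_lim0 _ nd.
have [l' fl' _] := nondecreasing_limy _ nd.
by split; [have [] := scaled_limit _ _ _ _ c0 fl|
           have [] := scaled_limit _ _ _ _ c0 fl'].
Qed.

Lemma ext_derive_le {R : realType} (f : R -> R) (n : nat) (c a y : R) :
  c != 0 -> smooth_on_pos f -> (forall x, 0 < x -> 0 <= c * derive1n n.+1 f x) ->
  0 <= a <= y -> 0 < y ->
  (c%:E * ext_derive f n a%:E <= (c * derive1n n f y)%:E)%E.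
Proof.
move=> c0 sf cf /andP[a0 ay] y0; have nd := derive1n_nondecreasing f n c sf cf.
rewrite /ext_derive; case: eqVneq => [_|a0'].
  have [l fl ly] := nondecreasing_lim0 _ nd.
  by have [_ ->] := scaled_limit _ _ _ _ c0 fl; exact: ly.
by rewrite -EFinM lee_fin nd// lt_def a0' a0.
Qed.

Lemma ext_derive_ge {R : realType} (f : R -> R) (n : nat) (c y : R)
    (b : \bar R) :
  c != 0 -> smooth_on_pos f -> (forall x, 0 < x -> 0 <= c * derive1n n.+1 f x) ->
  0 < y -> (y%:E <= b)%E ->
  ((c * derive1n n f y)%:E <= c%:E * ext_derive f n b)%E.
Proof.
move=> c0 sf cf y0; have nd := derive1n_nondecreasing f n c sf cf.
case: b => [b| |] //=; rewrite ?lee_fin => yb.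
  by rewrite gt_eqF ?(lt_le_trans y0)// -EFinM lee_fin nd.
have [l fl ly] := nondecreasing_limy _ nd.
by have [_ ->] := scaled_limit _ _ _ _ c0 fl; exact: ly.
Qed.

Lemma ext_derive_lt {R : realType} (f : R -> R) (n : nat) (c a y : R) :
  c != 0 -> smooth_on_pos f -> (forall x, 0 < x -> 0 < c * derive1n n.+1 f x) ->
  0 <= a < y ->
  (c%:E * ext_derive f n a%:E < (c * derive1n n f y)%:E)%E.
Proof.
move=> c0 sf cf /andP[a0 ay]; pose z := (a + y) / 2.
have /andP[az zy] : a < z < y by rewrite /z; apply/andP; split; lra.
have z0 : 0 < z by exact: le_lt_trans az.
apply: (@le_lt_trans _ _ (c * derive1n n f z)%:E).
  by apply: ext_derive_le; rewrite ?a0 ?ltW// => x x0; exact/ltW/cf.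
by rewrite lte_fin (derive1n_increasing f n c sf cf).
Qed.

Lemma ext_derive_gt {R : realType} (f : R -> R) (n : nat) (c y : R)
    (b : \bar R) :
  c != 0 -> smooth_on_pos f -> (forall x, 0 < x -> 0 < c * derive1n n.+1 f x) ->
  0 < y -> (y%:E < b)%E ->
  ((c * derive1n n f y)%:E < c%:E * ext_derive f n b)%E.
Proof.
move=> c0 sf cf y0 yb.
(* An intermediate real point again supplies strictness: [b] itself if finite, [y + 1] if [b] is
   infinite. *)
have [z yz zb] : exists2 z, y < z & (z%:E <= b)%E.
  case: b yb => [b| |] //; last by exists (y + 1); rewrite ?leey// ltrDl.
  by rewrite lte_fin => yb; exists b.
apply: (@lt_le_trans _ _ (c * derive1n n f z)%:E).
  by rewrite lte_fin (derive1n_increasing f n c sf cf).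
by apply: ext_derive_ge => //; [move=> x x0; exact/ltW/cf|exact: lt_trans yz].
Qed.

(* [e] is 1 for a completely increasing and -1 for a completely decreasing [f]. *)
Lemma node_sum_bounds {R : realType} (f : R -> R) (n : nat) (x : 'I_n.+1 -> R)
    (e a : R) (b : \bar R) :
  let m := \big[Num.min/x ord0]_(i < n.+1) x i in
  let M := \big[Num.max/x ord0]_(i < n.+1) x i in
  let c := e * ((-1) ^+ n / n`!%:R) in
  e != 0 -> smooth_on_pos f -> (forall i, 0 < x i) -> injective x ->
  0 <= a <= m -> (M%:E <= b)%E ->
  ((forall t, 0 < t -> 0 <= c * derive1n n.+1 f t) ->
    (e%:E * scaled_ext_derive f n a%:E <= (e * node_sum f x)%:E)%E /\
    ((e * node_sum f x)%:E <= e%:E * scaled_ext_derive f n b)%E) /\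
  ((forall t, 0 < t -> 0 < c * derive1n n.+1 f t) ->
    ((0 < n)%N \/ a != m ->
      (e%:E * scaled_ext_derive f n a%:E < (e * node_sum f x)%:E)%E) /\
    ((0 < n)%N \/ b != M%:E ->
      ((e * node_sum f x)%:E < e%:E * scaled_ext_derive f n b)%E)).
Proof.
move=> m M c e0 sf x0 xI /andP[a0 am] Mb.
have xmM i : m <= x i <= M by rewrite /m /M bigmin_le_cond//= le_bigmax_cond.
have [xi [xi0 /andP[mxi xiM] xin ->]] :=
  node_sum_mean_value f n x m M sf x0 xI xmM.
have c0 : c != 0.
  by rewrite mulf_neq0// mulf_neq0 ?signr_eq0// invr_eq0 pnatr_eq0 -lt0n fact_gt0.
rewrite /scaled_ext_derive !muleA -!EFinM (mulrA e (_ / _)) -/c.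
split=> cf; split.
- by apply: ext_derive_le => //; rewrite a0 (le_trans am mxi).
- by apply: ext_derive_ge => //; apply: le_trans Mb; rewrite lee_fin.
(* Strictness needs [a < xi]: for [n > 0] it comes from [m < xi], otherwise from [a < m]. *)
- move=> na; apply: ext_derive_lt => //; rewrite a0/=.
  case: na => [/xin/andP[mx _]|am']; first exact: le_lt_trans mx.
  by apply: lt_le_trans mxi; rewrite lt_neqAle am' am.
- move=> nb; apply: ext_derive_gt => //.
  case: nb => [/xin/andP[_ xM]|bM]; first exact: lt_le_trans Mb.
  by apply: (@le_lt_trans _ _ M%:E) => //; rewrite lt_neqAle eq_sym bM Mb.
Qed.

(* There are n.+1 nodes, so that the order of the derivative is n.
   For a single node the strict left (right) inequality is asserted only when
   a (respectively b) differs from that node, where it would read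
   f (x ord0) < f (x ord0). *)
Theorem proposition1 (R : realType) (f : R -> R) :
  (completely_increasing f \/ completely_decreasing f ->
     forall n : nat,
       cvg ((derive1n n f x)%:E @[x --> 0^'+]) /\
       cvg ((derive1n n f x)%:E @[x --> +oo]))
  /\
  (forall (n : nat) (x : 'I_n.+1 -> R),
     (forall i, 0 < x i) -> injective x ->
     let m := \big[Num.min/x ord0]_(i < n.+1) x i in
     let M := \big[Num.max/x ord0]_(i < n.+1) x i in
     forall (a : R) (b : \bar R), 0 <= a <= m -> (M%:E <= b)%E ->
     [/\ completely_increasing f ->
           (scaled_ext_derive f n a%:E <= (node_sum f x)%:E)%E /\
           ((node_sum f x)%:E <= scaled_ext_derive f n b)%E,
         completely_decreasing f ->
           (scaled_ext_derive f n b <= (node_sum f x)%:E)%E /\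
           ((node_sum f x)%:E <= scaled_ext_derive f n a%:E)%E,
         strictly_completely_increasing f ->
           ((0 < n)%N \/ a != m ->
              (scaled_ext_derive f n a%:E < (node_sum f x)%:E)%E) /\
           ((0 < n)%N \/ b != M%:E ->
              ((node_sum f x)%:E < scaled_ext_derive f n b)%E) &
         strictly_completely_decreasing f ->
           ((0 < n)%N \/ b != M%:E ->
              (scaled_ext_derive f n b < (node_sum f x)%:E)%E) /\
           ((0 < n)%N \/ a != m ->
              ((node_sum f x)%:E < scaled_ext_derive f n a%:E)%E)]).
Proof.
have fact0 n : 0 < n`!%:R^-1 :> R by rewrite invr_gt0 ltr0n fact_gt0.
(* Passing from exponent [n] to [n.+1] flips the sign, so the sign conditions on derivative [n.+1]
   give positivity with [e = 1] in the increasing case and [e = -1] in the decreasing one. *)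
have coefE (e : R) n t : e * ((-1) ^+ n / n`!%:R) * derive1n n.+1 f t =
    n`!%:R^-1 * (- e * ((-1) ^+ n.+1 * derive1n n.+1 f t)).
  by rewrite exprS; ring.
have coef0 (e : R) n : e != 0 -> e * ((-1) ^+ n / n`!%:R) != 0.
  by move=> e0; rewrite mulf_neq0// mulf_neq0 ?signr_eq0 ?gt_eqF.
have ci n : completely_increasing f ->
    forall t, 0 < t -> 0 <= 1 * ((-1) ^+ n / n`!%:R) * derive1n n.+1 f t.
  case=> _ _ ft t t0; rewrite coefE pmulr_rge0// mulN1r oppr_ge0.
  exact: ft.
have cd n : completely_decreasing f ->
    forall t, 0 < t -> 0 <= (-1) * ((-1) ^+ n / n`!%:R) * derive1n n.+1 f t.
  case=> _ _ ft t t0; rewrite coefE pmulr_rge0// opprK mul1r.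
  exact: ft.
have sci n : strictly_completely_increasing f ->
    forall t, 0 < t -> 0 < 1 * ((-1) ^+ n / n`!%:R) * derive1n n.+1 f t.
  case=> _ _ ft t t0; rewrite coefE pmulr_rgt0// mulN1r oppr_gt0.
  exact: ft.
have scd n : strictly_completely_decreasing f ->
    forall t, 0 < t -> 0 < (-1) * ((-1) ^+ n / n`!%:R) * derive1n n.+1 f t.
  case=> _ _ ft t t0; rewrite coefE pmulr_rgt0// opprK mul1r.
  exact: ft.
have N10 : -1 != 0 :> R by rewrite oppr_eq0 oner_eq0.
split=> [[] fc n|n x x0 xI m M a b am Mb].
- by have [_ sf _] := fc; exact: cvg_derive1n (coef0 _ n (oner_neq0 R)) sf (ci n fc).
- by have [_ sf _] := fc; exact: cvg_derive1n (coef0 _ n N10) sf (cd n fc).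
have pos sf := node_sum_bounds f n x 1 a b (oner_neq0 R) sf x0 xI am Mb.
(* Here both sides are negated; removing the signs reverses the inequalities and swaps the roles of
   [a] and [b]. *)
have neg sf := node_sum_bounds f n x (-1) a b N10 sf x0 xI am Mb.
rewrite EFinM !mul1e in pos; rewrite EFinM EFinN !mulN1e in neg.
split=> fc; have [_ sf _] := fc.
- by have [+ _] := pos sf; apply; exact: ci.
- have [/(_ (cd n fc))[] + + _] := neg sf.
  by rewrite !leeN2.
- by have [_] := pos sf; apply; exact: sci.
- have [_ /(_ (scd n fc))[]] := neg sf.
  by rewrite !lteN2.
Qed.
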